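(* Let $L$ be a first-order language, let $\{\mathcal{A}_\lambda : \lambda \in \Lambda\}$ be a family of $L$-structures, and let $\mathcal{A} = \prod_{\lambda\in\Lambda}\mathcal{A}_\lambda$ be the direct product. Consider the following conditions. (A) The two-element Boolean algebra $\{0,1\}$ is uniformly interpretable in the structures $\mathcal{A}_\lambda$ via positive primitive $L$-formulae $\Theta_{\mathcal{B}}, \Theta_=, \Theta_0, \Theta_1, \Theta_\triangle, \Theta_\triangledown, \Theta_C$; and moreover for every atomic $L$-formula $\phi(\bar{x})$ the formula $\Theta_0(\bar{y}) \vee \phi(\bar{x})$ is uniformly equivalent in the structures $\mathcal{A}_\lambda$ to a positive primitive formula $\phi_0(\bar{x},\bar{y})$ (i.e. one and the same $\phi_0$ works for all $\lambda \in \Lambda$). (B) The Boolean algebra $\mathcal{P}(\Lambda)$ is interpretable in $\mathcal{A}$, by an interpretation in which $K_\phi$ is represented for every atomic $L$-formula $\phi$. (C) The Boolean algebra $\mathcal{P}(\Lambda)$ is interpretable in $\mathcal{A}$, by an interpretation in which $K_\varphi$ is represented for every $L$-formula $\varphi$. (D) The full generalized product of the family $\{\mathcal{A}_\lambda : \lambda\in\Lambda\}$ is definable in $\mathcal{A}$ (i.e. every relation $\mathcal{Q}_\xi^{\mathcal{A}}$ is definable in $\mathcal{A}$ by an $L$-formula), and the $L$-definable (without parameters) subsets of the finite powers $\mathcal{A}^n$ are exactly the sets $\mathcal{Q}_\xi^{\mathcal{A}}$ defined by acceptable sequences $\xi$. Then $(A) \Rightarrow (B)$, $(B) \iff (C)$,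 and $(C) \Rightarrow (D)$.
   Context: Direct product: $\prod_{\lambda}\mathcal{A}_\lambda$ has universe the Cartesian product; constants and functions are interpreted coordinatewise, and a relation symbol $R$ holds of $\bar{a}$ iff $\mathcal{A}_\lambda \models R(\bar{a}[\lambda])$ for every $\lambda \in\Lambda$. Here, for $\bar{a}=(a_1,\dots,a_n)$, $\bar{a}[\lambda] = (a_1(\lambda),\dots,a_n(\lambda))$. ''$\bar a \in \mathcal{A}$'' abbreviates $\bar{a}\in\mathcal{A}^n$ for the appropriate $n$. For a formula $\Theta$, $\Theta^{\mathcal{A}}$ is the set of tuples of $\mathcal{A}$ satisfying $\Theta$. $L_{Bool} = \{0,1,\triangledown,\triangle,{}^C\}$ is the language of Boolean algebras (join $\triangledown$, meet $\triangle$, complement ${}^C$); $\mathcal{P}(\Lambda)$ is the power set algebra with $0=\emptyset$, $1=\Lambda$, $\triangledown=\cup$, $\triangle=\cap$, ${}^C$ = complement in $\Lambda$. Positive primitive formula: a formula logically equivalent to one of the form $\exists \bar{y}\bigwedge \Phi$ with $\Phi$ a (finite) set of atomic formulae. Interpretation: a Boolean algebra $\mathcal{B}$ is interpretable in an $L$-structure $\mathcal{M}$ if there are $L$-formulae $\Theta_{\mathcal{B}}(\bar x), \Theta_=(\bar x,\bar y), \Theta_0(\bar x), \Theta_1(\bar x), \Theta_\triangle(\bar x,\bar y,\bar z), \Theta_\triangledown(\bar x,\bar y,\bar z), \Theta_C(\bar x,\bar y)$ (with $\bar x,\bar y,\bar z$ tuples of variables of one fixed length) and a surjection $F : (\Theta_{\mathcal{B}})^{\mathcal{M}}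 \to \mathcal{B}$ such that for all $\bar x,\bar y,\bar z\in (\Theta_{\mathcal{B}})^{\mathcal{M}}$: $F(\bar x)=F(\bar y)$ iff $\mathcal{M}\models\Theta_=(\bar x,\bar y)$; $F(\bar x)=0^{\mathcal{B}}$ iff $\mathcal{M}\models\Theta_0(\bar x)$; $F(\bar x)=1^{\mathcal{B}}$ iff $\mathcal{M}\models\Theta_1(\bar x)$; $F(\bar x)\triangle F(\bar y)=F(\bar z)$ iff $\mathcal{M}\models\Theta_\triangle(\bar x,\bar y,\bar z)$; $F(\bar x)\triangledown F(\bar y)=F(\bar z)$ iff $\mathcal{M}\models\Theta_\triangledown(\bar x,\bar y,\bar z)$; $F(\bar x)^C=F(\bar y)$ iff $\mathcal{M}\models\Theta_C(\bar x,\bar y)$. ''Uniformly interpretable in the structures $\mathcal{A}_\lambda$'' means that the same formulae serve for all $\lambda\in\Lambda$, with surjections $F_\lambda$. For an $L$-formula $\theta(\bar{x})$ and $\bar a\in\mathcal{A}$, $K_\theta(\bar{a}) := \{\lambda\in\Lambda : \mathcal{A}_\lambda\models\theta(\bar{a}[\lambda])\}$. Given an interpretation of $\mathcal{P}(\Lambda)$ in $\mathcal{A}$ by $(F,\Theta_{\mathcal{B}},\dots)$, $K_\theta$ is represented by an $L$-formula $\Upsilon_\theta(\bar{x},\bar{y})$ if for all $\bar{a}\in\mathcal{A}$ and $\bar{b}\in(\Theta_{\mathcal{B}})^{\mathcal{A}}$: $\mathcal{A}\models\Upsilon_\theta(\bar{a},\bar{b})$ iff $F(\bar{b})=K_\theta(\bar{a})$.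 $K_\theta$ is represented if it is represented by some $L$-formula. Acceptable sequence: $\xi=\langle\Phi;\theta_1,\dots,\theta_m\rangle$ with $\Phi$ an $L_{Bool}$-formula with free variables among $y_1,\dots,y_m$, and each $\theta_i$ an $L$-formula; the free variables of $\xi$ are those of $\theta_1,\dots,\theta_m$. For $\xi$ in free variables $x_1,\dots,x_n$, $\mathcal{Q}_\xi^{\mathcal{A}} := \{\bar{a}\in\mathcal{A}^n : \mathcal{P}(\Lambda)\models\Phi(K_{\theta_1}(\bar{a}),\dots,K_{\theta_m}(\bar{a}))\}$. The full generalized product of $\{\mathcal{A}_\lambda\}$ is the relational structure with the universe of $\prod_\lambda\mathcal{A}_\lambda$ and all relations $\mathcal{Q}_\xi^{\mathcal{A}}$. All formulae here are without parameters. *)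

(* Defs.v *)
From mathcomp Require Import all_boot all_order.
From mathcomp Require Import boolp classical_sets functions.

Set Implicit Arguments.
Unset Strict Implicit.
Unset Printing Implicit Defensive.

Local Open Scope classical_set_scope.

(* Constants are function symbols of arity 0. *)
Record language := Language {
  funsym : Type;
  relsym : Type;
  fun_arity : funsym -> nat;
  rel_arity : relsym -> nat }.

(* As usual in first-order logic, structures are non-empty. *)
Record structure (L : language) := Structure {
  carrier :> Type;
  carrier_inhabited : inhabited carrier;
  fun_interp : forall f : funsym L, (fun_arity f).-tuple carrier -> carrier;
  rel_interp : forall r : relsym L, (rel_arity r).-tuple carrier -> Prop }.

(* The variables of [term L n] and the free variables of [formula L n] are
   among x_0, ..., x_(n-1). *)
Inductive term (L : language) (n : nat) : Type :=
| Var of 'I_n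
| App (f : funsym L) of ('I_(fun_arity f) -> term L n).

(* The quantifier of [Ex phi] binds the variable x_0 of [phi]; the variable
   x_(i+1) of [phi] is the variable x_i of [Ex phi].  The connectives and the
   quantifier not listed here are the usual classical abbreviations. *)
Inductive formula (L : language) : nat -> Type :=
| Top n : formula L n
| Equal n : term L n -> term L n -> formula L n
| Rel n (r : relsym L) : ('I_(rel_arity r) -> term L n) -> formula L n
| Not n : formula L n -> formula L n
| And n : formula L n -> formula L n -> formula L n
| Ex n : formula L n.+1 -> formula L n.

Arguments Top {L n}.

Section Semantics.
Variables (L : language) (M : structure L).

Fixpoint eval n (e : n.-tuple M) (t : term L n) : M :=
  match t with
  | Var i => tnth e i
  | App f args => fun_interp [tuple eval e (args i) | i < fun_arity f]
  end.

Fixpoint sat n (phi : formula L n) : n.-tuple M -> Prop :=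
  match phi in formula _ n return n.-tuple M -> Prop with
  | Top _ => fun _ => True
  | Equal _ t u => fun e => eval e t = eval e u
  | Rel _ r args =>
      fun e => rel_interp [tuple eval e (args i) | i < rel_arity r]
  | Not _ phi1 => fun e => ~ sat phi1 e
  | And _ phi1 phi2 => fun e => sat phi1 e /\ sat phi2 e
  | Ex _ phi1 => fun e => exists x : M, sat phi1 [tuple of x :: e]
  end.

Definition solutions n (phi : formula L n) : set (n.-tuple M) :=
  [set e | sat phi e].

Definition definable n (S : set (n.-tuple M)) : Prop :=
  exists phi : formula L n, S = solutions phi.

End Semantics.

Arguments sat {L} M {n} phi e.
Arguments solutions {L} M {n} phi.
Arguments definable {L} M {n} S.

Definition atomic L n (phi : formula L n) : bool :=
  match phi with
  | Equal _ _ _ | Rel _ _ _ => true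
  | _ => false
  end.

Definition logically_equivalent L n (phi psi : formula L n) : Prop :=
  forall (M : structure L) (e : n.-tuple M), sat M phi e <-> sat M psi e.

Definition bigand L n (Phi : seq (formula L n)) : formula L n :=
  foldr (@And L n) Top Phi.

Fixpoint ex_block L n m : formula L (m + n) -> formula L n :=
  match m return formula L (m + n) -> formula L n with
  | 0 => id
  | m'.+1 => fun phi => ex_block (Ex phi)
  end.

Definition positive_primitive L n (phi : formula L n) : Prop :=
  exists (m : nat) (Phi : seq (formula L (m + n))),
    all (@atomic L (m + n)) Phi /\
    logically_equivalent phi (ex_block (bigand Phi)).

Section Product.
Variables (L : language) (Lambda : Type) (A : Lambda -> structure L).

Lemma product_inhabited : inhabited (forall l, A l).
Proof.
exact: inhabits (fun l => inhabited_witness (carrier_inhabited (A l))).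
Qed.

(* The tuple a[l]. *)
Definition coord n (a : n.-tuple (forall l, A l)) (l : Lambda) :
    n.-tuple (A l) :=
  [tuple tnth a i l | i < n].

Definition product : structure L :=
  @Structure L (forall l, A l) product_inhabited
    (fun f a l => fun_interp (coord a l))
    (fun r a => forall l, rel_interp (coord a l)).

Definition K n (theta : formula L n) (a : n.-tuple product) : set Lambda :=
  [set l | sat (A l) theta (coord a l)].

End Product.

Variant bool_symbol := Zero | One | Join | Meet | Compl.

Definition bool_arity (s : bool_symbol) : nat :=
  match s with Zero | One => 0 | Join | Meet => 2 | Compl => 1 end.

Definition LBool : language :=
  @Language bool_symbol void bool_arity (fun r => match r with end).

Definition bool_interp d (B : ctbDistrLatticeType d) (s : bool_symbol) :
    (bool_arity s).-tuple B -> B :=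
  match s return (bool_arity s).-tuple B -> B with
  | Zero => fun _ => \bot%O
  | One => fun _ => \top%O
  | Join => fun a : 2.-tuple B => (tnth a ord0 `|` tnth a ord_max)%O
  | Meet => fun a : 2.-tuple B => (tnth a ord0 `&` tnth a ord_max)%O
  | Compl => fun a : 1.-tuple B => (~` tnth a ord0)%O
  end.

(* A Boolean algebra, i.e. a [ctbDistrLatticeType], as an LBool-structure.
   The Boolean algebra P(Lambda) is the one on [set Lambda] of
   [classical_sets], and the two-element one is [bool]. *)
Definition bool_structure d (B : ctbDistrLatticeType d) : structure LBool :=
  @Structure LBool B (inhabits \bot%O) (@bool_interp d B)
    (fun r => match r with end).

Record interp_formulas (L : language) := InterpFormulas {
  dim : nat;
  Theta_B : formula L dim;
  Theta_eq : formula L (dim + dim);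
  Theta_0 : formula L dim;
  Theta_1 : formula L dim;
  Theta_meet : formula L (dim + (dim + dim));
  Theta_join : formula L (dim + (dim + dim));
  Theta_compl : formula L (dim + dim) }.

(* [F] is the surjection of the interpretation; it is a function on
   [solutions M (Theta_B T)], and its values elsewhere are irrelevant. *)
Definition interprets L (M : structure L) d (B : ctbDistrLatticeType d)
    (T : interp_formulas L) (F : (dim T).-tuple M -> B) : Prop :=
  set_surj (solutions M (Theta_B T)) [set: B] F /\
  forall x y z : (dim T).-tuple M,
    sat M (Theta_B T) x -> sat M (Theta_B T) y -> sat M (Theta_B T) z ->
    [/\ F x = F y <-> sat M (Theta_eq T) [tuple of x ++ y],
        F x = \bot%O <-> sat M (Theta_0 T) x
      & F x = \top%O <-> sat M (Theta_1 T) x] /\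
    [/\ (F x `&` F y)%O = F z <-> sat M (Theta_meet T) [tuple of x ++ y ++ z],
        (F x `|` F y)%O = F z <-> sat M (Theta_join T) [tuple of x ++ y ++ z]
      & (~` F x)%O = F y <-> sat M (Theta_compl T) [tuple of x ++ y]].

Definition positive_primitive_interp L (T : interp_formulas L) : Prop :=
  [/\ positive_primitive (Theta_B T),
      positive_primitive (Theta_eq T),
      positive_primitive (Theta_0 T)
    & positive_primitive (Theta_1 T)] /\
  [/\ positive_primitive (Theta_meet T),
      positive_primitive (Theta_join T)
    & positive_primitive (Theta_compl T)].

Section Conditions.
Variables (L : language) (Lambda : Type) (A : Lambda -> structure L).

Definition uniformly_interprets d (B : ctbDistrLatticeType d)
    (T : interp_formulas L) : Prop :=
  forall l, exists F : (dim T).-tuple (A l) -> B, interprets F.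

Definition represented (T : interp_formulas L)
    (F : (dim T).-tuple (product A) -> set Lambda)
    n (theta : formula L n) : Prop :=
  exists Upsilon : formula L (n + dim T),
  forall (a : n.-tuple (product A)) (b : (dim T).-tuple (product A)),
    sat (product A) (Theta_B T) b ->
    (sat (product A) Upsilon [tuple of a ++ b] <-> F b = K theta a).

(* Acceptable sequences <Phi; theta_1, ..., theta_m> in n free variables. *)
Record acceptable (n : nat) := Acceptable {
  acc_len : nat;
  acc_Phi : formula LBool acc_len;
  acc_theta : acc_len.-tuple (formula L n) }.

Definition Q n (xi : acceptable n) : set (n.-tuple (product A)) :=
  [set a | sat (bool_structure (set Lambda)) (acc_Phi xi)
             [tuple K (tnth (acc_theta xi) i) a | i < acc_len xi]].

Definition generalized_product_language : language :=
  @Language void {n : nat & acceptable n} (fun f => match f with end) (@tag _ _).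

Definition full_generalized_product : structure generalized_product_language :=
  @Structure generalized_product_language (product A) (product_inhabited A)
    (fun f => match f with end) (fun r => Q (tagged r)).

(* The full generalized product has no function symbols and the same universe
   as the direct product. *)
Definition full_generalized_product_definable : Prop :=
  forall r : relsym generalized_product_language,
    definable (product A)
      ([set a | @rel_interp _ full_generalized_product r a]
        : set ((rel_arity r).-tuple (product A))).

Definition condition_A : Prop :=
  exists T : interp_formulas L,
    [/\ positive_primitive_interp T,
        uniformly_interprets bool T
      & forall n (phi : formula L n), atomic phi ->
          exists phi0 : formula L (n + dim T),
            positive_primitive phi0 /\
            forall l (x : n.-tuple (A l)) (y : (dim T).-tuple (A l)),
              (sat (A l) (Theta_0 T) y \/ sat (A l) phi x) <->
              sat (A l) phi0 [tuple of x ++ y]].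

Definition condition_B : Prop :=
  exists (T : interp_formulas L)
         (F : (dim T).-tuple (product A) -> set Lambda),
    interprets F /\
    forall n (phi : formula L n), atomic phi -> represented F phi.

Definition condition_C : Prop :=
  exists (T : interp_formulas L)
         (F : (dim T).-tuple (product A) -> set Lambda),
    interprets F /\
    forall n (phi : formula L n), represented F phi.

Definition condition_D : Prop :=
  full_generalized_product_definable /\
  forall n (S : set (n.-tuple (product A))),
    definable (product A) S <-> exists xi : acceptable n, S = Q xi.

End Conditions.

(* Main.v *)
(* (A) => (B): positive primitive formulas hold in the product iff they hold in
   every coordinate, so the uniform interpretations of {0,1} glue to one of
   P(Lambda); as [phi_0(a, b)] says that [F b] is contained in [K_phi(a)], the
   set [K_phi(a)] is named by the [b] that is maximal with this property.
   (B) => (C): [K] commutes with the connectives, and [K_(exists x phi)(a)] is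
   the largest of the sets [K_phi(x, a)], a maximum being attained by choosing
   a witness in each coordinate.
   (C) => (D): the interpretation translates LBool-formulas about the sets
   [K_theta(a)] into L-formulas about [a], so the sets Q_xi are definable; that
   conversely every definable set is some Q_xi is the Feferman-Vaught theorem. *)
Require Import Defs.
From mathcomp Require Import all_boot all_order.
From mathcomp Require Import boolp classical_sets functions.

Set Implicit Arguments.
Unset Strict Implicit.
Unset Printing Implicit Defensive.

Import Order.TTheory Order.CTheory.
Local Open Scope classical_set_scope.

(** * Selecting and concatenating coordinates of tuples *)

Section Tuples.
Variable T : Type.

Definition tfst k n (e : (k + n).-tuple T) : k.-tuple T :=
  [tuple tnth e (lshift n i) | i < k].

Definition tsnd k n (e : (k + n).-tuple T) : n.-tuple T :=
  [tuple tnth e (rshift k i) | i < n].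

Lemma tfst_cat k n (x : k.-tuple T) (e : n.-tuple T) :
  tfst [tuple of x ++ e] = x.
Proof. by apply: eq_from_tnth => i; rewrite tnth_mktuple tnth_lshift. Qed.

Lemma tsnd_cat k n (x : k.-tuple T) (e : n.-tuple T) :
  tsnd [tuple of x ++ e] = e.
Proof. by apply: eq_from_tnth => i; rewrite tnth_mktuple tnth_rshift. Qed.

Lemma mktuple_cat U (f : T -> U) k n (x : k.-tuple T) (e : n.-tuple T) :
  [tuple f (tnth [tuple of x ++ e] i) | i < k + n] =
  [tuple of [tuple f (tnth x i) | i < k] ++ [tuple f (tnth e i) | i < n]].
Proof.
apply: eq_from_tnth => i; rewrite tnth_mktuple; case: (fintype.splitP i) => j ij.
  rewrite (_ : i = lshift n j) ?tnth_lshift ?tnth_mktuple //; exact: val_inj.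
by rewrite (_ : i = rshift k j) ?tnth_rshift ?tnth_mktuple //; exact: val_inj.
Qed.

(* [selects t]: [t e] is obtained from [e] by selecting coordinates, so that
   substituting [t] in a formula is a renaming of variables. *)
Definition selects n k (t : n.-tuple T -> k.-tuple T) : Prop :=
  exists f : 'I_k -> 'I_n, forall e i, tnth (t e) i = tnth e (f i).

Lemma selects_id n : selects (fun e : n.-tuple T => e).
Proof. by exists id. Qed.

Lemma selects_tfst n k m (t : n.-tuple T -> (k + m).-tuple T) :
  selects t -> selects (fun e => tfst (t e)).
Proof.
by move=> [f ft]; exists (fun i => f (lshift m i)) => e i; rewrite tnth_mktuple.
Qed.

Lemma selects_tsnd n k m (t : n.-tuple T -> (k + m).-tuple T) :
  selects t -> selects (fun e => tsnd (t e)).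
Proof.
by move=> [f ft]; exists (fun i => f (rshift k i)) => e i; rewrite tnth_mktuple.
Qed.

Lemma selects_cat n k m (t : n.-tuple T -> k.-tuple T)
    (u : n.-tuple T -> m.-tuple T) :
  selects t -> selects u -> selects (fun e => [tuple of t e ++ u e]).
Proof.
move=> [f ft] [g gu].
exists (fun i => match fintype.split i with inl j => f j | inr j => g j end) => e i.
case: fintype.splitP => j ij.
  by rewrite (_ : i = lshift m j) ?tnth_lshift //; exact: val_inj.
by rewrite (_ : i = rshift k j) ?tnth_rshift //; exact: val_inj.
Qed.

(** A nested instance of [selects_cat], restated for the flat form in which triple concatenations
    are written, so that proof search can match it. *)
Lemma selects_cat3 n k m p (t : n.-tuple T -> k.-tuple T)
    (u : n.-tuple T -> m.-tuple T) (v : n.-tuple T -> p.-tuple T) :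
  selects t -> selects u -> selects v ->
  selects (fun e => [tuple of t e ++ u e ++ v e]).
Proof. by move=> st su sv; exact: selects_cat st (selects_cat su sv). Qed.

End Tuples.

Create HintDb selects.
#[local] Hint Resolve selects_id selects_tfst selects_tsnd selects_cat
  selects_cat3 : selects.

(** * Renaming of variables *)

Section Renaming.
Variable L : language.

Fixpoint rename_term n m (f : 'I_n -> 'I_m) (t : term L n) : term L m :=
  match t with
  | Var i => Var L (f i)
  | App g args => App (fun i => rename_term f (args i))
  end.

Definition lift_renaming n m (f : 'I_n -> 'I_m) (i : 'I_n.+1) : 'I_m.+1 :=
  if unlift ord0 i is Some j then lift ord0 (f j) else ord0.

(** The target length [m] is quantified after the formula because it grows by one under each
    quantifier. *)
Fixpoint rename n (phi : formula L n) : forall m, ('I_n -> 'I_m) -> formula L m :=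
  match phi in formula _ n return forall m, ('I_n -> 'I_m) -> formula L m with
  | Top _ => fun m f => Top
  | Equal _ t u => fun m f => Equal (rename_term f t) (rename_term f u)
  | Rel _ r args => fun m f => Rel (fun i => rename_term f (args i))
  | Not _ phi1 => fun m f => Not (rename phi1 f)
  | And _ phi1 phi2 => fun m f => And (rename phi1 f) (rename phi2 f)
  | Ex _ phi1 => fun m f => Ex (rename phi1 (lift_renaming f))
  end.

Variable M : structure L.

Lemma eval_rename n m (f : 'I_n -> 'I_m) (t : term L n) (e : m.-tuple M) :
  eval e (rename_term f t) = eval [tuple tnth e (f i) | i < n] t.
Proof.
elim: t => [i|g args IH] /=; first by rewrite tnth_mktuple.
by congr fun_interp; apply: eq_from_tnth => i; rewrite !tnth_mktuple.
Qed.

Lemma sat_rename n (phi : formula L n) m (f : 'I_n -> 'I_m) (e : m.-tuple M) :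
  sat M (rename phi f) e <-> sat M phi [tuple tnth e (f i) | i < n].
Proof.
elim: phi m f e => {n} [n|n t u|n r args|n phi IH|n phi1 IH1 phi2 IH2|n phi IH]
    m f e /=.
- by [].
- by rewrite !eval_rename.
- set a := (X in rel_interp X <-> _); set b := (X in _ <-> rel_interp X).
  suff -> : a = b by [].
  by apply: eq_from_tnth => i; rewrite !tnth_mktuple eval_rename.
- by rewrite IH.
- by rewrite IH1 IH2.
- have E x : [tuple tnth [tuple of x :: e] (lift_renaming f i) | i < n.+1] =
             [tuple of x :: [tuple tnth e (f i) | i < n]].
    apply: eq_from_tnth => i; rewrite tnth_mktuple /lift_renaming.
    by case: unliftP => [j ->|->]; rewrite ?tnthS ?tnth0 ?tnth_mktuple.
  by split=> -[x]; [rewrite IH E|rewrite -E -IH] => ?; exists x.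
Qed.

Lemma sat_ex_block m n (phi : formula L (m + n)) (e : n.-tuple M) :
  sat M (ex_block phi) e <->
  exists x : m.-tuple M, sat M phi [tuple of x ++ e].
Proof.
elim: m phi => [|m IH] phi.
  have E (x : 0.-tuple M) : [tuple of x ++ e] = e.
    by rewrite (tuple0 x); exact: val_inj.
  by split=> [phie|[x]]; [exists [tuple]; rewrite E|rewrite E].
(* The innermost quantifier of the block binds the first entry of the tuple, so that entry is the
   one split off. *)
have E (y : M) (x : m.-tuple M) :
    [tuple of y :: [tuple of x ++ e]] = [tuple of [tuple of y :: x] ++ e].
  exact: val_inj.
rewrite /= IH /=; split=> [[x [y H]]|[x]].
  by exists [tuple of y :: x]; rewrite -E.
by case/tupleP: x => y x H; exists x, y; rewrite E.
Qed.

Lemma sat_bigand_map (I : eqType) n (f : I -> formula L n) (r : seq I)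
    (e : n.-tuple M) :
  sat M (bigand [seq f i | i <- r]) e <-> forall i, i \in r -> sat M (f i) e.
Proof.
elim: r => [|i r IH] /=; first by split.
rewrite IH; split=> [[fi fr] j|H].
  by rewrite inE => /predU1P[->|/fr].
by split=> [|j jr]; apply: H; rewrite inE ?eqxx ?jr ?orbT.
Qed.

End Renaming.

(** * Closure properties of definability *)

Section Definability.
Variables (L : language) (M : structure L).

Lemma definableP n (S : set (n.-tuple M)) :
  definable M S <-> exists phi : formula L n, forall e, S e <-> sat M phi e.
Proof.
split=> [[phi ->]|[phi H]]; exists phi; first by [].
by apply/funext => e; exact/propext.
Qed.

Lemma eq_definable n (S S' : set (n.-tuple M)) :
  (forall e, S e <-> S' e) -> definable M S -> definable M S'.
Proof. by move=> H; have -> : S = S' by apply/funext => e; exact/propext. Qed.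

Lemma definable_comp n k (S : set (k.-tuple M)) (t : n.-tuple M -> k.-tuple M) :
  selects t -> definable M S -> definable M (fun e => S (t e)).
Proof.
move=> [f tf] /definableP[phi H]; apply/definableP; exists (rename phi f) => e.
by rewrite sat_rename H (_ : t e = [tuple tnth e (f i) | i < k]) //;
  apply: eq_from_tnth => i; rewrite tnth_mktuple.
Qed.

Lemma definable_sat n k (phi : formula L k) (t : n.-tuple M -> k.-tuple M) :
  selects t -> definable M (fun e => sat M phi (t e)).
Proof. by move=> st; apply: definable_comp st _; exists phi. Qed.

Lemma definable_not n (S : set (n.-tuple M)) :
  definable M S -> definable M (fun e => ~ S e).
Proof.
by move=> /definableP[phi H]; apply/definableP; exists (Not phi) => e /=; rewrite H.
Qed.

Lemma definable_and n (S S' : set (n.-tuple M)) :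
  definable M S -> definable M S' -> definable M (fun e => S e /\ S' e).
Proof.
move=> /definableP[phi H] /definableP[phi' H']; apply/definableP.
by exists (And phi phi') => e /=; rewrite H H'.
Qed.

Lemma definable_or n (S S' : set (n.-tuple M)) :
  definable M S -> definable M S' -> definable M (fun e => S e \/ S' e).
Proof.
move=> dS dS'; have := definable_not
  (definable_and (definable_not dS) (definable_not dS')).
by apply: eq_definable => e; rewrite -not_orP notK.
Qed.

Lemma definable_imp n (S S' : set (n.-tuple M)) :
  definable M S -> definable M S' -> definable M (fun e => S e -> S' e).
Proof.
move=> dS dS'; have := definable_or (definable_not dS) dS'.
by apply: eq_definable => e; rewrite implyE.
Qed.

(** The bound tuple is put in front of the environment: under nested quantifiers [tfst] reads the
    latest bound tuple, and iterated [tsnd] leads back to the earlier ones. *)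
Lemma definable_ex n k (P : k.-tuple M -> n.-tuple M -> Prop) :
  definable M (fun e : (k + n).-tuple M => P (tfst e) (tsnd e)) ->
  definable M (fun e => exists x, P x e).
Proof.
move=> /definableP[phi H]; apply/definableP; exists (ex_block phi) => e.
rewrite sat_ex_block.
by split=> -[x Px]; exists x; [apply/H|move/H: Px]; rewrite tfst_cat tsnd_cat.
Qed.

Lemma definable_all n k (P : k.-tuple M -> n.-tuple M -> Prop) :
  definable M (fun e : (k + n).-tuple M => P (tfst e) (tsnd e)) ->
  definable M (fun e => forall x, P x e).
Proof.
move=> dP; have := definable_not
  (@definable_ex n k (fun x e => ~ P x e) (definable_not dP)).
by apply: eq_definable => e; rewrite -forallNP; split=> H x;
  [exact: contrapT (H x)|move=> /(_ (H x))].
Qed.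

Lemma definable_finite_all n (I : finType) (P : I -> set (n.-tuple M)) :
  (forall i, definable M (P i)) -> definable M (fun e => forall i, P i e).
Proof.
move=> dP; have /choice[f fP] i := (definableP (P i)).1 (dP i).
apply/definableP; exists (bigand [seq f i | i <- enum I]) => e.
rewrite sat_bigand_map; split=> [H i _|H i]; first exact/fP.
by apply/fP/H; rewrite mem_enum.
Qed.

End Definability.

(** * Representable Boolean-valued functions *)

Section Interpretation.
Variables (L : language) (M : structure L) (d : Order.disp_t).
Variables (B : ctbDistrLatticeType d) (T : interp_formulas L).
Variables (F : (dim T).-tuple M -> B).
Hypothesis FT : interprets F.

Definition denotes (c : (dim T).-tuple M) (b : B) : Prop :=
  sat M (Theta_B T) c /\ F c = b.

(** The graph of [G], pulled back along [F], is definable. Closure under Boolean operations is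
    proved for arbitrary such [G], with the functions [K theta] as the intended case. *)
Definition representable n (G : n.-tuple M -> B) : Prop :=
  definable M (fun e : (dim T + n).-tuple M => denotes (tfst e) (G (tsnd e))).

Lemma denotes_ex b : exists c, denotes c b.
Proof. by have [c cT <-] := FT.1 b I; exists c. Qed.

Lemma definable_denotes n k (c : n.-tuple M -> (dim T).-tuple M)
    (t : n.-tuple M -> k.-tuple M) (G : k.-tuple M -> B) :
  representable G -> selects c -> selects t ->
  definable M (fun e => denotes (c e) (G (t e))).
Proof.
move=> rG sc st; have := definable_comp (selects_cat sc st) rG.
by apply: eq_definable => e; rewrite tfst_cat tsnd_cat.
Qed.

Lemma representable_comp n k (t : n.-tuple M -> k.-tuple M)
    (G : k.-tuple M -> B) :
  representable G -> selects t -> representable (fun e => G (t e)).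
Proof.
move=> rG [f tf]; apply: (definable_denotes (t := fun e => t (tsnd e)) rG).
  by auto with selects.
by exists (fun i => rshift _ (f i)) => e i; rewrite tf tnth_mktuple.
Qed.

Lemma representable_bot n : representable (fun _ : n.-tuple M => \bot%O).
Proof.
apply: (@eq_definable _ _ _
  (fun e => sat M (Theta_B T) (tfst e) /\ sat M (Theta_0 T) (tfst e))).
  move=> e; split=> -[cT H]; split=> //;
    by have [[_ K _] _] := FT.2 _ _ _ cT cT cT; apply/K.
by apply: definable_and; apply: definable_sat; auto with selects.
Qed.

Lemma representable_top n : representable (fun _ : n.-tuple M => \top%O).
Proof.
apply: (@eq_definable _ _ _
  (fun e => sat M (Theta_B T) (tfst e) /\ sat M (Theta_1 T) (tfst e))).
  move=> e; split=> -[cT H]; split=> //;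
    by have [[_ _ K] _] := FT.2 _ _ _ cT cT cT; apply/K.
by apply: definable_and; apply: definable_sat; auto with selects.
Qed.

(** By surjectivity [G e] has a name [x]; the names of its complement are the tuples of the domain
    that [Theta_compl] relates to [x]. *)
Lemma representable_compl n (G : n.-tuple M -> B) :
  representable G -> representable (fun e => ~` G e)%O.
Proof.
move=> rG; rewrite /representable.
apply: (@eq_definable _ _ _ (fun e => exists x, denotes x (G (tsnd e)) /\
  (sat M (Theta_B T) (tfst e) /\ sat M (Theta_compl T) [tuple of x ++ tfst e]))).
  move=> e; split=> [[x [[xT <-] [cT H]]]|[cT ce]].
    split=> //; have [_ [_ _ K]] := FT.2 _ _ _ xT cT cT.
    by apply/esym/K.
  have [x [xT xe]] := denotes_ex (G (tsnd e)); exists x; do 2!split=> //.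
  by have [_ [_ _ H]] := FT.2 _ _ _ xT cT cT; apply/H; rewrite ce xe.
apply: definable_ex; apply: definable_and; last apply: definable_and.
- by apply: definable_denotes; auto with selects.
- by apply: definable_sat; auto with selects.
- by apply: definable_sat; auto with selects.
Qed.

Lemma representable_meet n (G H : n.-tuple M -> B) :
  representable G -> representable H -> representable (fun e => G e `&` H e)%O.
Proof.
move=> rG rH; rewrite /representable.
apply: (@eq_definable _ _ _ (fun e => exists x, denotes x (G (tsnd e)) /\
  exists y, denotes y (H (tsnd e)) /\
  (sat M (Theta_B T) (tfst e) /\
   sat M (Theta_meet T) [tuple of x ++ y ++ tfst e]))).
  move=> e; split=> [[x [[xT <-] [y [[yT <-] [cT xyc]]]]]|[cT ce]].
    split=> //; have [_ [K _ _]] := FT.2 _ _ _ xT yT cT.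
    by apply/esym/K.
  have [x [xT xe]] := denotes_ex (G (tsnd e)); exists x; split=> //.
  have [y [yT ye]] := denotes_ex (H (tsnd e)); exists y; do 2!split=> //.
  by have [_ [K _ _]] := FT.2 _ _ _ xT yT cT; apply/K; rewrite ce xe ye.
apply: definable_ex; apply: definable_and.
  by apply: definable_denotes; auto with selects.
(* The environment is now [x], then the candidate name of the meet, then the arguments, whence the
   nested projections. *)
apply: (@definable_ex _ _ _ _ (fun y e => denotes y (H (tsnd (tsnd e))) /\
  (sat M (Theta_B T) (tfst (tsnd e)) /\
   sat M (Theta_meet T) [tuple of tfst e ++ y ++ tfst (tsnd e)]))).
apply: definable_and; last apply: definable_and.
- by apply: (definable_denotes (t := fun e => tsnd (tsnd (tsnd e)))) => //;
    auto with selects.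
- by apply: definable_sat; auto with selects.
- by apply: definable_sat; auto 6 with selects.
Qed.

(** De Morgan's law reduces the join to complements and a meet. *)
Lemma representable_join n (G H : n.-tuple M -> B) :
  representable G -> representable H -> representable (fun e => G e `|` H e)%O.
Proof.
move=> rG rH.
rewrite (_ : (fun e => _) = (fun e => ~` (~` G e `&` ~` H e))%O); last first.
  by apply/funext => e; rewrite complI !complK.
by apply: representable_compl; apply: representable_meet;
  apply: representable_compl.
Qed.

(** Every value has a name and a name has only one value, so equality of values amounts to having a
    common name. *)
Lemma definable_eq_representable n (G H : n.-tuple M -> B) :
  representable G -> representable H -> definable M (fun e => G e = H e).
Proof.
move=> rG rH.
apply: (@eq_definable _ _ _ (fun e => exists x, denotes x (G e) /\ denotes x (H e))).
  move=> e; split=> [[x [[_ <-] [_ <-]]] //|GH].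
  by have [x xG] := denotes_ex (G e); exists x; rewrite -GH.
by apply: definable_ex; apply: definable_and; apply: definable_denotes;
  auto with selects.
Qed.

(* Off the domain of the interpretation [F] is arbitrary, hence possibly not
   representable. *)
Definition total_interp (c : (dim T).-tuple M) : B :=
  if `[< sat M (Theta_B T) c >] then F c else \bot%O.

Lemma total_interpE c b : denotes c b -> total_interp c = b.
Proof. by move=> [cT <-]; rewrite /total_interp asboolT. Qed.

(** On the domain, [Theta_eq] recognizes the other names of the same value; off the domain the value
    is bottom, and its names are recognized by [Theta_0]. *)
Lemma representable_total_interp n (t : n.-tuple M -> (dim T).-tuple M) :
  selects t -> representable (fun e => total_interp (t e)).
Proof.
move=> st; apply: (@representable_comp _ _ _ total_interp) st.
apply: (@eq_definable _ _ _ (fun e => sat M (Theta_B T) (tfst e) /\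
  ((sat M (Theta_B T) (tsnd e) /\ sat M (Theta_eq T) [tuple of tfst e ++ tsnd e])
   \/ (~ sat M (Theta_B T) (tsnd e) /\ sat M (Theta_0 T) (tfst e))))).
  move=> e; rewrite /denotes /total_interp.
  split=> -[cT H]; split=> //; have [[_ c0 _] _] := FT.2 _ _ _ cT cT cT.
    case: H => -[eT H]; last by rewrite asboolF //; exact/c0.
    by rewrite asboolT //; have [[K _ _] _] := FT.2 _ _ _ cT eT eT; apply/K.
  have [eT|eT] := pselect (sat M (Theta_B T) (tsnd e)).
    left; split=> //; rewrite asboolT // in H.
    by have [[K _ _] _] := FT.2 _ _ _ cT eT eT; apply/K.
  by right; split=> //; rewrite asboolF // in H; exact/c0.
apply: definable_and; first by apply: definable_sat; auto with selects.
apply: definable_or; apply: definable_and;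
  try apply: definable_not; apply: definable_sat; auto with selects.
Qed.

Lemma representable_eval n m (t : term LBool m) (G : 'I_m -> n.-tuple M -> B) :
  (forall i, representable (G i)) ->
  representable (fun e =>
    @eval _ (bool_structure B) _ [tuple G i e | i < m] t).
Proof.
move=> rG; elim: t => [i|s args IH].
  rewrite (_ : (fun e => _) = G i) //.
  by apply/funext => e; rewrite /= tnth_mktuple.
case: s args IH => args IH.
- exact: representable_bot.
- exact: representable_top.
- have := representable_join (IH ord0) (IH ord_max); congr representable.
  by apply/funext => e; rewrite /= !tnth_mktuple.
- have := representable_meet (IH ord0) (IH ord_max); congr representable.
  by apply/funext => e; rewrite /= !tnth_mktuple.
- have := representable_compl (IH ord0); congr representable.
  by apply/funext => e; rewrite /= !tnth_mktuple.
Qed.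

(** This is the translation of [LBool]-formulas into [L]-formulas, by induction on [Phi]. A
    quantifier over [B] becomes a quantifier over tuples [c] standing for [total_interp c], which
    reaches every element of [B]. The family [G] is generalized because each quantifier adds a
    member to it. *)
Lemma definable_sat_representable m (Phi : formula LBool m) n
    (G : 'I_m -> n.-tuple M -> B) :
  (forall i, representable (G i)) ->
  definable M (fun e => sat (bool_structure B) Phi [tuple G i e | i < m]).
Proof.
elim: Phi n G => {m} [m|m t u|m []|m phi IH|m phi1 IH1 phi2 IH2|m phi IH] n G rG /=.
- by apply/definableP; exists Top.
- by apply: definable_eq_representable; apply: representable_eval.
- by apply: definable_not; exact: IH.
- by apply: definable_and; [exact: IH1|exact: IH2].
(* Variable 0 takes the value of the newly bound tuple; the old values ignore that tuple and read
   the rest of the environment. *)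
- pose G' (i : 'I_m.+1) (e : (dim T + n).-tuple M) : B :=
    if unlift ord0 i is Some j then G j (tsnd e) else total_interp (tfst e).
  have rG' i : representable (G' i).
    rewrite /G'; case: unlift => [j|].
      by apply: (representable_comp (t := @tsnd _ _ _)) => //; auto with selects.
    by apply: representable_total_interp; auto with selects.
  have E e : [tuple G' i e | i < m.+1] =
      [tuple of total_interp (tfst e) :: [tuple G i (tsnd e) | i < m]].
    apply: eq_from_tnth => i; rewrite tnth_mktuple /G'.
    by case: unliftP => [j ->|->]; rewrite ?tnthS ?tnth0 ?tnth_mktuple.
  apply: (@eq_definable _ _ _ (fun e => exists c : (dim T).-tuple M,
    sat (bool_structure B) phi
      [tuple of total_interp c :: [tuple G i e | i < m]])).
    move=> e; split=> [[c]|[b]]; first by exists (total_interp c).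
    by have [c /total_interpE <-] := denotes_ex b; exists c.
  apply: definable_ex.
  by apply: eq_definable (IH _ _ rG') => e; rewrite E.
Qed.

End Interpretation.

(** * Direct products *)

Section Product.
Variables (L : language) (Lambda : Type) (A : Lambda -> structure L).
Implicit Types (l : Lambda).

Lemma eval_product n (e : n.-tuple (product A)) (t : term L n) l :
  eval e t l = eval (coord e l) t.
Proof.
elim: t => [i|f args IH] /=; first by rewrite tnth_mktuple.
by congr fun_interp; apply: eq_from_tnth => i; rewrite !tnth_mktuple.
Qed.

Lemma sat_atomic_product n (phi : formula L n) (e : n.-tuple (product A)) :
  atomic phi -> sat (product A) phi e <-> K phi e = setT.
Proof.
move=> aphi; suff -> : sat (product A) phi e <->
    forall l, sat (A l) phi (coord e l).
  by split=> [H|H l]; [apply/seteqP; split=> l // _; exact: H|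
                       have : K phi e l by rewrite H].
case: phi e aphi => {n} // [n t u|n r args] e _ /=.
  split=> [tu l|tu]; first by rewrite -!eval_product tu.
  by apply: functional_extensionality_dep => l; rewrite !eval_product; exact: tu.
suff E l : coord [tuple eval e (args i) | i < rel_arity r] l =
    [tuple eval (coord e l) (args i) | i < rel_arity r].
  by split=> H l; have := H l; rewrite E.
by apply: eq_from_tnth => i; rewrite !tnth_mktuple eval_product.
Qed.

Lemma coord_cat k n (x : k.-tuple (product A)) (e : n.-tuple (product A)) l :
  coord [tuple of x ++ e] l = [tuple of coord x l ++ coord e l].
Proof. exact: (mktuple_cat (fun x : product A => x l)). Qed.

Lemma coord_cat3 k m n (x : k.-tuple (product A)) (y : m.-tuple (product A))
    (z : n.-tuple (product A)) l :
  coord [tuple of x ++ y ++ z] l =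
  [tuple of coord x l ++ coord y l ++ coord z l].
Proof.
by rewrite (coord_cat x [tuple of y ++ z]); congr cat_tuple; exact: coord_cat.
Qed.

(** By choice, the coordinates of a tuple of the product can be prescribed independently of each
    other. *)
Lemma coord_surj n (P : forall l, n.-tuple (A l) -> Prop) :
  (forall l, exists y, P l y) ->
  exists x : n.-tuple (product A), forall l, P l (coord x l).
Proof.
move=> /(_ _)/cid exP; pose y l := projT1 (exP l).
exists [tuple ((fun l => tnth (y l) i) : product A) | i < n] => l.
rewrite (_ : coord _ l = y l); first exact: (projT2 (exP l)).
by apply: eq_from_tnth => i; rewrite !tnth_mktuple.
Qed.

(** Atomic formulas and their conjunctions are evaluated coordinatewise, and witnesses of the
    existential block found in the single factors are glued by [coord_surj]. *)
Lemma sat_pp_product n (phi : formula L n) (e : n.-tuple (product A)) :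
  positive_primitive phi ->
  sat (product A) phi e <-> forall l, sat (A l) phi (coord e l).
Proof.
move=> [m [Phi [aPhi PhiE]]].
have PhiP (x : (m + n).-tuple (product A)) : sat (product A) (bigand Phi) x <->
    forall l, sat (A l) (bigand Phi) (coord x l).
  elim: Phi aPhi {PhiE} => [|psi Phi IH] /=; first by split.
  move=> /andP[apsi aPhi]; rewrite (IH aPhi) (sat_atomic_product x apsi).
  split=> [[Kx Phix] l|H]; last first.
    by split=> [|l]; [apply/seteqP; split=> l // _|]; have [] := H l.
  by split=> //; have : K psi x l by rewrite Kx.
rewrite PhiE sat_ex_block; split=> [[x /PhiP xP] l|H].
  by rewrite PhiE sat_ex_block; exists (coord x l); rewrite -coord_cat.
have [|x xP] := @coord_surj m
    (fun l y => sat (A l) (bigand Phi) [tuple of y ++ coord e l]).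
  by move=> l; have := H l; rewrite PhiE sat_ex_block.
by exists x; apply/PhiP => l; rewrite coord_cat.
Qed.

(** A single quantifier viewed as a block of length 1, the form suited to [coord_surj] and
    [definable_ex]. *)
Lemma sat_Ex (M : structure L) n (phi : formula L n.+1) (e : n.-tuple M) :
  sat M (Ex phi) e <-> exists x : 1.-tuple M, sat M phi [tuple of x ++ e].
Proof. exact: (@sat_ex_block _ M 1). Qed.

Lemma K_Ex_sub n (phi : formula L n.+1) (x : 1.-tuple (product A))
    (a : n.-tuple (product A)) :
  K phi [tuple of x ++ a] `<=` K (Ex phi) a.
Proof.
move=> l; rewrite /K /= (coord_cat x a) => xP.
by apply/sat_Ex; exists (coord x l).
Qed.

Lemma K_Ex_witness n (phi : formula L n.+1) (a : n.-tuple (product A)) :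
  exists x : 1.-tuple (product A), K phi [tuple of x ++ a] = K (Ex phi) a.
Proof.
have [|x xP] := @coord_surj 1 (fun l y => K (Ex phi) a l ->
    sat (A l) phi [tuple of y ++ coord a l]).
  move=> l; have [/sat_Ex[y yP]|nK] := pselect (K (Ex phi) a l).
    by exists y.
  (* Where no witness exists nothing is required, and any element of the non-empty factor serves as
     a default. *)
  by exists [tuple inhabited_witness (carrier_inhabited (A l))].
exists x; apply/seteqP; split=> [|l /xP]; first exact: K_Ex_sub.
by rewrite -(coord_cat x a).
Qed.

(** The two notions differ in the order of the variables and in whether membership in the domain is
    a premise or part of the definable relation. *)
Lemma representedE (T : interp_formulas L)
    (F : (dim T).-tuple (product A) -> set Lambda) n (theta : formula L n) :
  represented F theta <-> representable F (K theta).
Proof.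
split=> [[U UP]|/definableP[U UP]].
  apply: (@eq_definable _ _ _ (fun e => sat (product A) (Theta_B T) (tfst e) /\
    sat (product A) U [tuple of tsnd e ++ tfst e])).
    by move=> e; split=> -[eT H]; split=> //; exact/(UP _ _ eT).
  by apply: definable_and; apply: definable_sat; auto with selects.
have /definableP[V VP] : definable (product A) (fun e : (n + dim T).-tuple _ =>
    sat (product A) U [tuple of tsnd e ++ tfst e]).
  by apply: definable_sat; auto with selects.
exists V => a b bT; rewrite -VP tfst_cat tsnd_cat -UP tfst_cat tsnd_cat.
by rewrite /denotes; split=> [[]|].
Qed.

(** * From condition (A) to condition (B) *)

Lemma eq_set_bool (U : Type) (X Y : U -> bool) :
  [set u | X u] = [set u | Y u] <-> forall u, X u = Y u.
Proof.
split=> [E u|/funext -> //]; have Eu : X u = Y u :> Prop.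
  exact: (congr1 (fun S : set U => S u) E).
by apply/idP/idP; rewrite Eu.
Qed.

Lemma condition_A_to_B : condition_A A -> condition_B A.
Proof.
move=> [T [[[pB peq p0 p1] [pmeet pjoin pcompl]] uT atomT]].
have /(_ _)/cid iT := uT; pose f l := projT1 (iT l).
have fT l : interprets (f l) := projT2 (iT l).
pose F (b : (dim T).-tuple (product A)) := [set l | f l (coord b l)].
have FT : interprets F.
  split=> [X _|x y z].
    have [|b bP] := @coord_surj (dim T)
      (fun l y => sat (A l) (Theta_B T) y /\ f l y = `[< X l >]).
      by move=> l; have [y yT fy] := (fT l).1 `[< X l >] I; exists y.
    exists b; first by apply/sat_pp_product => // l; have [] := bP l.
    by apply/funext => l; apply/propext; rewrite /F /= (bP l).2 asboolE.
  rewrite !sat_pp_product // => xT yT zT.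
  have bot : \bot%O = [set l : Lambda | \bot%O : bool].
    by apply/seteqP; split.
  have top : \top%O = [set l : Lambda | \top%O : bool].
    by apply/seteqP; split.
  have meet (X Y : Lambda -> bool) :
      ([set l | X l] `&` [set l | Y l])%O = [set l | (X l `&` Y l)%O].
    by apply/seteqP; split=> l /= => [[-> ->]|/andP[]].
  have join (X Y : Lambda -> bool) :
      ([set l | X l] `|` [set l | Y l])%O = [set l | (X l `|` Y l)%O].
    by apply/seteqP; split=> l /orP.
  have compl (X : Lambda -> bool) :
      (~` [set l | X l])%O = [set l | (~` X l)%O].
    by apply/seteqP; split=> l /negP.
  (* Every set in sight now comes from a Boolean-valued function, so each clause splits by
     [eq_set_bool] into the same clause for [f l] at every [l]; the formulas split likewise, being
     positive primitive. *)
  rewrite bot top meet join compl.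
  do 2!split; rewrite eq_set_bool sat_pp_product //; split=> H l; move: (H l);
    rewrite ?coord_cat3 ?coord_cat;
    by have [[? ? ?] [? ? ?]] := (fT l).2 _ _ _ (xT l) (yT l) (zT l); tauto.
exists T, F; split=> // n phi aphi; apply/representedE.
have [phi0 [pphi0 phi0E]] := atomT n phi aphi.
(* [Theta_0] holds at coordinate [l] exactly when [l] is outside [F b], so the disjunction expressed
   by [phi0] is the implication from [l] in [F b] to [l] in [K phi a]. *)
have phi0P (a : n.-tuple (product A)) b : sat (product A) (Theta_B T) b ->
    sat (product A) phi0 [tuple of a ++ b] <-> F b `<=` K phi a.
  rewrite !sat_pp_product // => bT; split=> H l; move: (H l);
    rewrite coord_cat -phi0E;
    have [[_ b0 _] _] := (fT l).2 _ _ _ (bT l) (bT l) (bT l).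
    by case=> // /b0; rewrite /F /= => ->.
  by rewrite -b0 /F /=; case: (f l _) => Kl; [right; exact: Kl|left].
(* Applied to [x], [c], [x], the formula [Theta_meet] expresses that [F x] is contained in [F c];
   hence the last clause is the maximality of the named set. *)
apply: (@eq_definable _ _ _ (fun e => sat (product A) (Theta_B T) (tfst e) /\
  (sat (product A) phi0 [tuple of tsnd e ++ tfst e] /\
   forall x, sat (product A) (Theta_B T) x ->
     sat (product A) phi0 [tuple of tsnd e ++ x] ->
     sat (product A) (Theta_meet T) [tuple of x ++ tfst e ++ x]))).
  move=> e; split=> [[cT [/phi0P -/(_ cT) cK maxc]]|[cT ce]].
    split=> //; apply/seteqP; split=> //.
    (* Maximality is tested on a name of [K phi] itself. *)
    have [x xT xK] := FT.1 (K phi (tsnd e)) I.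
    have [_ [meetE _ _]] := FT.2 _ _ _ xT cT xT.
    have /meetE : sat (product A) (Theta_meet T) [tuple of x ++ tfst e ++ x].
      by apply: maxc => //; apply/phi0P => //; rewrite xK.
    by rewrite xK => /setIidPl.
  split=> //; split=> [|x xT /(phi0P _ _ xT) xK].
    by apply/phi0P => //; rewrite ce.
  have [_ [meetE _ _]] := FT.2 _ _ _ xT cT xT; apply/meetE.
  by apply/setIidPl; rewrite ce.
apply: definable_and; last apply: definable_and.
- by apply: definable_sat; auto with selects.
- by apply: definable_sat; auto with selects.
apply: (@definable_all _ _ _ _ (fun x e => _ x -> sat _ _ [tuple of tsnd e ++ x] ->
  sat _ _ [tuple of x ++ tfst e ++ x])).
by do 2?apply: definable_imp; apply: definable_sat; auto 6 with selects.
Qed.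

(** * Equivalence of conditions (B) and (C) *)

Lemma condition_C_to_B : condition_C A -> condition_B A.
Proof. by move=> [T [F [FT rF]]]; exists T, F; split=> // n phi _; exact: rF. Qed.

Lemma condition_B_to_C : condition_B A -> condition_C A.
Proof.
move=> [T [F [FT aF]]]; exists T, F; split=> // n phi; apply/representedE.
elim: phi => {n} [n|n t u|n r args|n phi IH|n phi1 IH1 phi2 IH2|n phi IH].
- rewrite (_ : K Top = fun _ => \top%O); first exact: representable_top.
  by apply/funext => a; apply/seteqP; split.
- exact/representedE/aF.
- exact/representedE/aF.
- rewrite (_ : K _ = fun a => (~` K phi a)%O); first exact: representable_compl.
  by apply/funext => a; apply/seteqP; split.
- rewrite (_ : K _ = fun a => (K phi1 a `&` K phi2 a)%O).
    exact: representable_meet.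
  by apply/funext => a; apply/seteqP; split.
(* [C] is an inclusion written as an equation between representable functions; [total_interp]
   replaces [F] because definability is needed for every tuple [c], also off the domain. [S] says
   that [c] names a largest set among the values of [K phi] as [x] varies. *)
- pose C (x : 1.-tuple (product A)) c (e : n.-tuple (product A)) :=
    (K phi [tuple of x ++ e] `&` total_interp F c)%O = K phi [tuple of x ++ e].
  pose S c (e : n.-tuple (product A)) := exists x : 1.-tuple (product A),
    denotes F c (K phi [tuple of x ++ e]) /\
    forall x' : 1.-tuple (product A), C x' c e.
  apply: (@eq_definable _ _ _ (fun e => S (tfst e) (tsnd e))).
    (* The witness [y] attains the bound [K (Ex phi)]: it supplies the required value in one
       direction, and comparison with it yields maximality in the other. *)
    move=> e; have [y yP] := K_Ex_witness phi (tsnd e).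
    split=> [[x [xc xmax]]|ec]; last first.
      exists y; rewrite yP; split=> // x; rewrite /C (total_interpE ec).
      exact/setIidPl/K_Ex_sub.
    split; first exact: xc.1.
    rewrite xc.2; apply/seteqP; split; first exact: K_Ex_sub.
    by have := xmax y; rewrite /C (total_interpE xc) yP => /setIidPl.
  apply: definable_ex; apply: definable_and.
    apply: (definable_denotes
      (t := fun e => [tuple of tfst e ++ tsnd (tsnd e)])) => //;
      auto with selects.
  apply: (@definable_all _ _ _ _ (fun x' e => C x' (tfst (tsnd e)) (tsnd (tsnd e)))).
  apply: (definable_eq_representable FT).
        apply: (representable_meet FT).
      apply: (representable_comp
        (t := fun e => [tuple of tfst e ++ tsnd (tsnd (tsnd e))])) => //.
      by auto with selects.
    apply: (representable_total_interp FT).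
    by auto with selects.
  apply: (representable_comp
    (t := fun e => [tuple of tfst e ++ tsnd (tsnd (tsnd e))])) => //.
  by auto with selects.
Qed.
End Product.

(** * The Feferman-Vaught theorem *)

Section PowerSetTerms.
Variable Lambda : Type.
Let P := bool_structure (set Lambda).

Definition boolean_term m (G : m.-tuple P -> set Lambda) : Prop :=
  exists t : term LBool m, forall e, eval e t = G e.

Lemma boolean_term_tnth m n (t : m.-tuple P -> n.-tuple P) i :
  selects t -> boolean_term (fun e => tnth (t e) i).
Proof. by move=> [f tf]; exists (Var LBool (f i)) => e; rewrite tf. Qed.

Lemma boolean_termT m : boolean_term (fun _ : m.-tuple P => setT).
Proof.
have f : 'I_0 -> term LBool m by case.
by exists (@App LBool m One f).
Qed.

Lemma boolean_termC m (G : m.-tuple P -> set Lambda) :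
  boolean_term G -> boolean_term (fun e => ~` G e).
Proof.
move=> [t tG]; exists (@App LBool m Compl (fun _ => t)) => e.
by rewrite /= tnth_mktuple tG.
Qed.

Lemma boolean_termI m (G H : m.-tuple P -> set Lambda) :
  boolean_term G -> boolean_term H -> boolean_term (fun e => G e `&` H e).
Proof.
move=> [t tG] [u uH].
exists (@App LBool m Meet (fun i => if i == ord0 then t else u)) => e.
by rewrite /= !tnth_mktuple tG uH.
Qed.

(** Inclusion is an equation between terms: the meet equals its first argument. *)
Lemma definable_sub m (G H : m.-tuple P -> set Lambda) :
  boolean_term G -> boolean_term H -> definable P (fun e => G e `<=` H e).
Proof.
move=> bG bH; have [t tGH] := boolean_termI bG bH; have [u uG] := bG.
apply/definableP; exists (Equal t u) => e /=; rewrite tGH uG.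
by split=> /setIidPl.
Qed.

(** As [s] varies, these are the regions of the Venn diagram of the sets [Y i]; each [l] lies in
    exactly one of them. *)
Definition cell (I : Type) (Y : I -> set Lambda) (s : I -> bool) : set Lambda :=
  [set l | forall i, Y i l <-> s i].

(** A cell is a finite intersection of sets [Y i] and complements; restricting the condition to a
    list of indices allows induction on that list. *)
Lemma boolean_term_cell m (I : finType) (Y : I -> m.-tuple P -> set Lambda)
    (s : I -> bool) :
  (forall i, boolean_term (Y i)) -> boolean_term (fun e => cell (Y^~ e) s).
Proof.
move=> bY.
have [t tP] : boolean_term (fun e =>
    [set l | forall i, i \in enum I -> Y i e l <-> s i]).
  elim: (enum I) => [|i r [t tr]].
    have [t tT] := boolean_termT m; exists t => e; rewrite tT.
    by apply/seteqP; split.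
  have bi : boolean_term (fun e => if s i then Y i e else ~` Y i e).
    by case: (s i) => //; exact: boolean_termC.
  have [u uP] := boolean_termI bi (ex_intro _ t tr); exists u => e; rewrite uP.
  apply/seteqP; split=> l /=.
    move=> [Yil Yr] j; rewrite inE => /predU1P[->|/Yr //].
    by move: Yil; case: (s i).
  move=> Yl; split=> [|j jr]; last by apply: Yl; rewrite inE jr orbT.
  have := Yl i (mem_head _ _).
  case: (s i) => -[H1 H2]; first exact: H2.
  by rewrite /setC /mkset => /H1.
exists t => e; rewrite tP; apply/seteqP; split=> l /= Yl i; last by move=> _.
by apply: Yl; rewrite mem_enum.
Qed.

End PowerSetTerms.

(** * Definable sets of the product as sets [Q xi] *)

Section FefermanVaught.
Variables (L : language) (Lambda : Type) (A : Lambda -> structure L).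
Let P := bool_structure (set Lambda).

(** Reduces the search for an acceptable sequence to the definability of a relation in P(Lambda),
    where the closure properties of definable sets apply. *)
Lemma eq_Q n m (theta : m.-tuple (formula L n)) (R : set (m.-tuple P))
    (S : set (n.-tuple (product A))) :
  definable P R -> (forall a, S a <-> R [tuple K (tnth theta i) a | i < m]) ->
  exists xi : acceptable L n, S = Q xi.
Proof.
move=> /definableP[Phi RPhi] SR; exists (Acceptable Phi theta).
by apply/funext => a; apply/propext; rewrite SR RPhi.
Qed.

Lemma Q_atomic n (phi : formula L n) : atomic phi ->
  exists xi : acceptable L n, solutions (product A) phi = Q xi.
Proof.
move=> aphi; apply: (@eq_Q _ 1 [tuple phi]
  (fun e => setT `<=` tnth e ord0)).
  apply: definable_sub; first exact: boolean_termT.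
  by apply: boolean_term_tnth; auto with selects.
move=> a; rewrite /solutions /= sat_atomic_product // tnth_mktuple (tnth_nth phi).
by split=> [->|H]; [|apply/seteqP; split].
Qed.

Lemma Q_top n : exists xi : acceptable L n, [set: n.-tuple (product A)] = Q xi.
Proof.
apply: (@eq_Q _ 0 [tuple] setT) => //.
by apply/definableP; exists Top.
Qed.

Lemma Q_not n (xi : acceptable L n) : exists xi' : acceptable L n,
  ~` (Q xi : set (n.-tuple (product A))) = Q xi'.
Proof. by exists (Acceptable (Not (acc_Phi xi)) (acc_theta xi)). Qed.

Lemma Q_and n (xi1 xi2 : acceptable L n) : exists xi : acceptable L n,
  (Q xi1 : set (n.-tuple (product A))) `&` Q xi2 = Q xi.
Proof.
apply: (@eq_Q _ _ [tuple of acc_theta xi1 ++ acc_theta xi2] (fun e =>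
  sat P (acc_Phi xi1) (tfst e) /\ sat P (acc_Phi xi2) (tsnd e))).
  by apply: definable_and; apply: definable_sat; auto with selects.
move=> a; rewrite (mktuple_cat (fun theta => K theta a)).
by rewrite tfst_cat tsnd_cat.
Qed.

(* The values [Y i] of [K (theta i)] on a tuple extending [a] are exactly the
   sets such that, at each [l], the pattern of the [i] with [Y i l] is realized
   by the [theta i] on some extension of [a[l]]; that a pattern is realized is
   again expressed by a formula. *)
Lemma Q_ex n (xi : acceptable L n.+1) : exists xi' : acceptable L n,
  [set a : n.-tuple (product A) |
    exists x : 1.-tuple (product A), Q xi [tuple of x ++ a]] = Q xi'.
Proof.
case: xi => m Phi theta.
pose lit (s : {ffun 'I_m -> bool}) i :=
  if s i then tnth theta i else Not (tnth theta i).
pose psi s := Ex (bigand [seq lit s i | i <- enum 'I_m]).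
have KpsiE s (a : n.-tuple (product A)) l : K (psi s) a l <->
    exists y : 1.-tuple (A l), forall i,
      sat (A l) (tnth theta i) [tuple of y ++ coord a l] <-> s i.
  rewrite /K /psi /mkset sat_Ex.
  have litE y : sat (A l) (bigand [seq lit s i | i <- enum 'I_m]) y <->
      forall i, sat (A l) (tnth theta i) y <-> s i.
    rewrite sat_bigand_map.
    have litE i : sat (A l) (lit s i) y <-> (sat (A l) (tnth theta i) y <-> s i).
      by rewrite /lit; case: (s i) => /=; split=> [H|[H1 H2]] //;
        [exact: H2|move=> /H1].
    split=> H i; first by apply/litE/H; rewrite mem_enum.
    by move=> _; exact/litE.
  by split=> -[y /litE yP]; exists y.
(* The new sequence has one formula [psi s] for each of the 2^m patterns, numbered by [enum_rank];
   the condition bounds each cell of [Y] by the set where its pattern is realizable. *)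
apply: (@eq_Q _ _ [tuple psi (enum_val j) | j < #|{ffun 'I_m -> bool}|] (fun Z =>
  exists Y : m.-tuple P, sat P Phi Y /\ forall s : {ffun 'I_m -> bool},
    cell (tnth Y) s `<=` tnth Z (enum_rank s))).
  apply: definable_ex; apply: definable_and.
    by apply: definable_sat; auto with selects.
  apply: definable_finite_all => s; apply: definable_sub.
    apply: (boolean_term_cell (Y := fun i e => tnth (tfst e) i)) => i.
    by apply: boolean_term_tnth; auto with selects.
  by apply: boolean_term_tnth; auto with selects.
have KE s a : tnth [tuple K (tnth [tuple psi (enum_val j) | j <
    #|{ffun 'I_m -> bool}|] i) a | i < #|{ffun 'I_m -> bool}|] (enum_rank s) =
    K (psi s) a.
  by rewrite !tnth_mktuple enum_rankK.
move=> a; split=> [[x Phix]|[Y [PhiY YP]]].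
  (* [Y] consists of the values of [K] at the given extension, so [coord x l] realizes the pattern
     of the cell containing [l]. *)
  eexists; split; first exact: Phix.
  move=> s l sl; rewrite KE; apply/KpsiE; exists (coord x l) => i.
  by rewrite -sl tnth_mktuple /K /= (coord_cat x a).
(* Conversely, each [l] lies in the cell of its own pattern [s], hence in [K (psi s) a]; the local
   witnesses obtained in this way are glued into [x]. *)
have [|x xP] := @coord_surj _ _ A 1 (fun l y => forall i : 'I_m,
    sat (A l) (tnth theta i) [tuple of y ++ coord a l] <-> tnth Y i l).
  move=> l; pose s := [ffun i => `[< tnth Y i l >]].
  have : K (psi s) a l.
    by rewrite -KE; apply: YP => i; rewrite ffunE asboolE.
  by move=> /KpsiE[y yP]; exists y => i; rewrite yP ffunE asboolE.
exists x; rewrite /Q /mkset /=.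
rewrite (_ : [tuple _ | _ < _] = Y) //; apply: eq_from_tnth => i.
rewrite tnth_mktuple; apply/funext => l; apply/propext.
by rewrite -xP /K /= (coord_cat x a).
Qed.

Lemma solutions_Q n (phi : formula L n) :
  exists xi : acceptable L n, solutions (product A) phi = Q xi.
Proof.
elim: phi => {n} [n|n t u|n r args|n phi [xi xiE]|n phi1 [xi1 E1] phi2 [xi2 E2]
                 |n phi [xi xiE]].
- exact: Q_top.
- exact: Q_atomic.
- exact: Q_atomic.
- by have [xi' E] := Q_not xi; exists xi'; rewrite -E -xiE.
- by have [xi E] := Q_and xi1 xi2; exists xi; rewrite -E -E1 -E2.
- have [xi' E] := Q_ex xi; exists xi'.
  by rewrite -E -xiE; apply/seteqP; split=> a /sat_Ex.
Qed.

Lemma condition_C_to_D : condition_C A -> condition_D A.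
Proof.
move=> [T [F [FT rF]]].
(* The functions [K theta] are representable by (C), so the translation of [LBool]-formulas applies
   to [acc_Phi xi]. *)
have dQ n (xi : acceptable L n) : definable (product A) (@Q _ _ A n xi).
  by apply: (definable_sat_representable FT) => i; exact/representedE.
split=> [[n xi]|n S]; first exact: dQ.
by split=> [[phi ->]|[xi ->]]; [exact: solutions_Q|exact: dQ].
Qed.

End FefermanVaught.

Theorem theorem3p6 (L : language) (Lambda : Type) (A : Lambda -> structure L) :
  (condition_A A -> condition_B A) /\
  (condition_B A <-> condition_C A) /\
  (condition_C A -> condition_D A).
Proof.
split; first exact: condition_A_to_B.
split; last exact: condition_C_to_D.
by split; [exact: condition_B_to_C|exact: condition_C_to_B].
Qed.
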